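(* Let $Q$ be a strong commutative semicartesian quantale. The categories $\mathbf{ScottQSet}_r$ (Scott-complete $Q$-sets with relational morphisms) and $\mathbf{QSet}_r$ (all $Q$-sets with relational morphisms) are equivalent: $$\mathbf{ScottQSet}_r\simeq\mathbf{QSet}_r.$$
   Context: A quantale is a complete lattice $(Q,\le)$ with an associative binary operation $\otimes$ that distributes over arbitrary suprema in each variable. It is commutative if $\otimes$ is commutative; semicartesian if $a\otimes b\le a\wedge b$ for all $a,b$; strong if for every $e\in Q$ with $e=e\otimes e$ and every $A\subseteq Q$, $e\le\bigvee_{a\in A}a$ implies $e\le\bigvee_{a\in A}a\otimes a$. A $Q$-set is a set $X$ with a map $\delta:X\times X\to Q$ such that for all $x,y,z$: $\delta(x,y)=\delta(y,x)$; $\delta(x,y)\otimes\delta(y,z)\le\delta(x,z)$; $\delta(x,x)\otimes\delta(x,y)=\delta(x,y)$. The extent of $x$ is $Ex:=\delta(x,x)$. A relational morphism $\phi:X\to Y$ is a function $\phi:X\times Y\to Q$ such that for all $x,x'\in X$, $y,y'\in Y$: $\delta(x,x')\otimes\phi(x,y)\le\phi(x',y)$; $\phi(x,y)\otimes\delta(y,y')\le\phi(x,y')$; $\phi(x,y)\otimes\phi(x,y')\le\delta(y,y')$; $\phi(x,y)\otimes Ey=\phi(x,y)$; $Ex\otimes\phi(x,y)=\phi(x,y)$; $\bigvee_{y\in Y}\phi(x,y)=Ex$. Composition is $[\psi\circ\phi](x,z)=\bigvee_{y\in Y}\phi(x,y)\otimes\psi(y,z)$ and the identity of $X$ is $\delta_X$;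 this is the category $\mathbf{QSet}_r$. A singleton on $X$ is a map $\sigma:X\to Q$ such that for all $x,y\in X$: $\sigma(x)\otimes Ex=\sigma(x)$; $\sigma(x)\otimes\delta(x,y)\le\sigma(y)$; $\sigma(x)\otimes\sigma(y)\le\delta(x,y)$; $\sigma(x)\otimes\bigvee_{y\in X}\sigma(y)=\sigma(x)$. An element $x_\sigma\in X$ represents $\sigma$ if $\sigma(y)=\delta(y,x_\sigma)$ for all $y\in X$. $X$ is Scott-complete if every singleton on $X$ has exactly one representing element. $\mathbf{ScottQSet}_r$ is the full subcategory of $\mathbf{QSet}_r$ on Scott-complete $Q$-sets. *)

(* Defs.v *)
From HB Require Import structures.
From mathcomp Require Import all_boot all_order.
From mathcomp Require Import boolp classical_sets.

Set Implicit Arguments.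
Unset Strict Implicit.
Unset Printing Implicit Defensive.

Import Order.TTheory.

Declare Scope cat_scope.
Delimit Scope cat_scope with cat.
Declare Scope quantale_scope.
Delimit Scope quantale_scope with QT.

Local Open Scope classical_set_scope.
Local Open Scope order_scope.

Record category := Category {
  obj :> Type;
  hom : obj -> obj -> Type;
  idm : forall x, hom x x;
  comp : forall x y z, hom y z -> hom x y -> hom x z;
  comp_idl : forall x y (f : hom x y), comp (idm y) f = f;
  comp_idr : forall x y (f : hom x y), comp f (idm x) = f;
  compA : forall x y z t (h : hom z t) (g : hom y z) (f : hom x y),
    comp h (comp g f) = comp (comp h g) f
}.

Arguments hom {c} x y.
Arguments idm {c} x.
Arguments comp {c x y z} g f.

Notation "g ∘ f" := (comp g f)
  (at level 40, left associativity) : cat_scope.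

Local Open Scope cat_scope.

Record functor (C D : category) := Functor {
  fobj :> C -> D;
  fmap : forall x y : C, hom x y -> hom (fobj x) (fobj y);
  fmap_id : forall x : C, fmap (idm x) = idm (fobj x);
  fmap_comp : forall (x y z : C) (g : hom y z) (f : hom x y),
    fmap (g ∘ f) = fmap g ∘ fmap f
}.

Arguments fmap {C D} f {x y} _ : rename.

Definition functor_id (C : category) : functor C C :=
  @Functor C C id (fun _ _ f => f) (fun _ => erefl) (fun _ _ _ _ _ => erefl).

Section FunctorComp.
Variables (C D E : category) (G : functor D E) (F : functor C D).

Let gf_fmap (x y : C) (f : hom x y) : hom (G (F x)) (G (F y)) :=
  fmap G (fmap F f).

Fact functor_comp_id (x : C) : gf_fmap (idm x) = idm (G (F x)).
Proof. by rewrite /gf_fmap !fmap_id. Qed.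

Fact functor_comp_comp (x y z : C) (g : hom y z) (f : hom x y) :
  gf_fmap (g ∘ f) = gf_fmap g ∘ gf_fmap f.
Proof. by rewrite /gf_fmap !fmap_comp. Qed.

Definition functor_comp : functor C E :=
  @Functor C E (fun x => G (F x)) gf_fmap functor_comp_id functor_comp_comp.

End FunctorComp.

Record nat_trans (C D : category) (F G : functor C D) := NatTrans {
  component :> forall x : C, hom (F x) (G x);
  naturality : forall (x y : C) (f : hom x y),
    component y ∘ fmap F f = fmap G f ∘ component x
}.

Definition is_iso (C : category) (x y : C) (f : hom x y) : Prop :=
  exists g : hom y x, g ∘ f = idm x /\ f ∘ g = idm y.

Definition nat_isomorphic (C D : category) (F G : functor C D) : Prop :=
  exists t : nat_trans F G, forall x : C, is_iso (t x).

Definition equivalent_categories (C D : category) : Prop :=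
  exists (F : functor C D) (G : functor D C),
    nat_isomorphic (functor_id C) (functor_comp G F) /\
    nat_isomorphic (functor_comp F G) (functor_id D).

Definition full_subcategory (C : category) (P : C -> Prop) : category :=
  @Category {x : C | P x} (fun x y => hom (sval x) (sval y))
    (fun x => idm (sval x)) (fun _ _ _ g f => g ∘ f)
    (fun _ _ f => comp_idl f) (fun _ _ f => comp_idr f)
    (fun _ _ _ _ h g f => compA h g f).

(* Arbitrary suprema suffice for a complete lattice: the infimum of A is the
   supremum of its lower bounds. *)
HB.mixin Record isCompleteLattice d Q of Order.Lattice d Q := {
  qsup : set Q -> Q;
  qsup_isLub : forall A : set Q, isLub A (qsup A)
}.

#[short(type="completeLatticeType")]
HB.structure Definition CompleteLattice d :=
  {Q of isCompleteLattice d Q & Order.Lattice d Q}.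

HB.mixin Record isQuantale d Q of CompleteLattice d Q := {
  tensor : Q -> Q -> Q;
  tensorA : associative tensor;
  tensor_supr : forall (a : Q) (B : set Q),
    tensor a (qsup B) = qsup [set tensor a b | b in B];
  tensor_supl : forall (A : set Q) (b : Q),
    tensor (qsup A) b = qsup [set tensor a b | a in A]
}.

#[short(type="quantaleType")]
HB.structure Definition Quantale d :=
  {Q of isQuantale d Q & CompleteLattice d Q}.

Notation "a ⊗ b" := (tensor a b)
  (at level 40, left associativity) : quantale_scope.

Notation "'\qsup_' i F" := (qsup (range (fun i => F)))
  (at level 34, i at level 0, F at level 41,
   format "'\qsup_' i  F") : quantale_scope.

Local Open Scope quantale_scope.

Definition commutative_quantale d (Q : quantaleType d) : Prop :=
  commutative (@tensor d Q).

Definition semicartesian d (Q : quantaleType d) : Prop :=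
  forall a b : Q, a ⊗ b <= Order.meet a b.

Definition strong d (Q : quantaleType d) : Prop :=
  forall (e : Q) (A : set Q), e = e ⊗ e ->
    e <= qsup A -> e <= qsup [set a ⊗ a | a in A].

Section QuantaleTheory.
Context {d : Order.disp_t} {Q : quantaleType d}.
Implicit Types (a b c : Q) (I : Type).

Lemma qsup_ub I (F : I -> Q) i : F i <= \qsup_j F j.
Proof. by apply: (qsup_isLub _).1; exists i. Qed.

Lemma qsup_ub_trans I (F : I -> Q) i a : a <= F i -> a <= \qsup_j F j.
Proof. by move=> aF; apply: le_trans aF (qsup_ub F i). Qed.

Lemma qsup_le I (F : I -> Q) a : (forall i, F i <= a) -> \qsup_j F j <= a.
Proof. by move=> Fa; apply: (qsup_isLub _).2 => _ [i _ <-]. Qed.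

Lemma eq_qsup I (F G : I -> Q) : F =1 G -> \qsup_i F i = \qsup_i G i.
Proof. by move=> /funext ->. Qed.

Lemma tensor_qsupr I a (F : I -> Q) : a ⊗ \qsup_i F i = \qsup_i (a ⊗ F i).
Proof. by rewrite tensor_supr image_comp. Qed.

Lemma tensor_qsupl I (F : I -> Q) a : (\qsup_i F i) ⊗ a = \qsup_i (F i ⊗ a).
Proof. by rewrite tensor_supl image_comp. Qed.

Lemma tensor_ler a b c : b <= c -> a ⊗ b <= a ⊗ c.
Proof.
move=> bc; have -> : c = \qsup_t (if t then b else c).
  apply/le_anti/andP; split; first exact: (qsup_ub (fun t => if t then b else c) false).
  by apply: qsup_le => -[].
rewrite tensor_qsupr.
exact: (qsup_ub (fun t => a ⊗ (if t then b else c)) true).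
Qed.

Lemma tensor_lel a b c : a <= b -> a ⊗ c <= b ⊗ c.
Proof.
move=> ab; have -> : b = \qsup_t (if t then a else b).
  apply/le_anti/andP; split; first exact: (qsup_ub (fun t => if t then a else b) false).
  by apply: qsup_le => -[].
rewrite tensor_qsupl.
exact: (qsup_ub (fun t => (if t then a else b) ⊗ c) true).
Qed.

Lemma tensor_le a a' b b' : a <= a' -> b <= b' -> a ⊗ b <= a' ⊗ b'.
Proof. by move=> aa bb; apply: le_trans (tensor_ler _ bb); apply: tensor_lel. Qed.

End QuantaleTheory.

Record qset d (Q : quantaleType d) := QSet {
  qcarrier :> Type;
  delta : qcarrier -> qcarrier -> Q;
  delta_sym : forall x y, delta x y = delta y x;
  delta_trans : forall x y z, delta x y ⊗ delta y z <= delta x z;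
  delta_ext : forall x y, delta x x ⊗ delta x y = delta x y
}.

Arguments delta {d Q q} x y : rename.

Definition extent d (Q : quantaleType d) (X : qset Q) (x : X) : Q := delta x x.

Record rel_mor d (Q : quantaleType d) (X Y : qset Q) := RelMor {
  rel_fun :> X -> Y -> Q;
  rel_deltal : forall x x' y, delta x x' ⊗ rel_fun x y <= rel_fun x' y;
  rel_deltar : forall x y y', rel_fun x y ⊗ delta y y' <= rel_fun x y';
  rel_functional : forall x y y', rel_fun x y ⊗ rel_fun x y' <= delta y y';
  rel_extr : forall x y, rel_fun x y ⊗ extent y = rel_fun x y;
  rel_extl : forall x y, extent x ⊗ rel_fun x y = rel_fun x y;
  rel_total : forall x, \qsup_y rel_fun x y = extent x
}.

Lemma rel_morP d (Q : quantaleType d) (X Y : qset Q) (f g : rel_mor X Y) :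
  (forall x y, f x y = g x y) -> f = g.
Proof.
case: f g => f f1 f2 f3 f4 f5 f6 [g g1 g2 g3 g4 g5 g6] /= fg.
have E : f = g by apply/funext => x; apply/funext => y.
by move: g1 g2 g3 g4 g5 g6; rewrite -E => *; congr RelMor; apply: Prop_irrelevance.
Qed.

Section QSetCategory.
Context {d : Order.disp_t} {Q : quantaleType d}.
Hypothesis QC : commutative_quantale Q.
Hypothesis QS : semicartesian Q.

Let tensor_lel1 (a b : Q) : a ⊗ b <= a.
Proof. by apply: le_trans (QS a b) _; apply: leIl. Qed.

Section Id.
Variable X : qset Q.

Fact rel_id_functional (x y y' : X) : delta x y ⊗ delta x y' <= delta y y'.
Proof. by rewrite (delta_sym x y); apply: delta_trans. Qed.

Fact rel_id_extr (x y : X) : delta x y ⊗ extent y = delta x y.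
Proof. by rewrite QC (delta_sym x y) delta_ext. Qed.

Fact rel_id_total (x : X) : \qsup_y delta x y = extent x.
Proof.
apply/le_anti/andP; split; last exact: (qsup_ub (fun y => delta x y) x).
by apply: qsup_le => y; rewrite -delta_ext; apply: tensor_lel1.
Qed.

Fact rel_id_deltal (x x' y : X) : delta x x' ⊗ delta x y <= delta x' y.
Proof. by rewrite (delta_sym x x'); apply: delta_trans. Qed.

Definition rel_id : rel_mor X X :=
  @RelMor d Q X X (fun x y => delta x y) rel_id_deltal (@delta_trans d Q X)
    rel_id_functional rel_id_extr (@delta_ext d Q X) rel_id_total.

End Id.

Section Comp.
Variables (X Y Z : qset Q) (psi : rel_mor Y Z) (phi : rel_mor X Y).

Let cfun (x : X) (z : Z) : Q := \qsup_y (phi x y ⊗ psi y z).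

Fact rel_comp_deltal x x' z : delta x x' ⊗ cfun x z <= cfun x' z.
Proof.
rewrite /cfun tensor_qsupr; apply: qsup_le => y; rewrite tensorA.
apply: le_trans (qsup_ub (fun y => phi x' y ⊗ psi y z) y).
exact/tensor_lel/rel_deltal.
Qed.

Fact rel_comp_deltar x z z' : cfun x z ⊗ delta z z' <= cfun x z'.
Proof.
rewrite /cfun tensor_qsupl; apply: qsup_le => y; rewrite -tensorA.
apply: le_trans (qsup_ub (fun y => phi x y ⊗ psi y z') y).
exact/tensor_ler/rel_deltar.
Qed.

Fact rel_comp_functional x z z' : cfun x z ⊗ cfun x z' <= delta z z'.
Proof.
rewrite /cfun tensor_qsupl; apply: qsup_le => y.
rewrite tensor_qsupr; apply: qsup_le => y'.
have -> : phi x y ⊗ psi y z ⊗ (phi x y' ⊗ psi y' z') =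
          phi x y ⊗ phi x y' ⊗ psi y z ⊗ psi y' z'.
  by rewrite -!tensorA; congr (_ ⊗ _); rewrite !tensorA (QC (psi y z)).
apply: le_trans (rel_functional psi y' z z').
apply/tensor_lel/(le_trans _ (rel_deltal psi y y' z))/tensor_lel.
exact: rel_functional.
Qed.

Fact rel_comp_extr x z : cfun x z ⊗ extent z = cfun x z.
Proof.
rewrite /cfun tensor_qsupl; apply: eq_qsup => y.
by rewrite -tensorA rel_extr.
Qed.

Fact rel_comp_extl x z : extent x ⊗ cfun x z = cfun x z.
Proof.
rewrite /cfun tensor_qsupr; apply: eq_qsup => y.
by rewrite tensorA rel_extl.
Qed.

Fact rel_comp_total x : \qsup_z cfun x z = extent x.
Proof.
rewrite -(rel_total phi x); apply/le_anti/andP; split.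
  apply: qsup_le => z; apply: qsup_le => y.
  by apply: le_trans (tensor_lel1 _ _) _; apply: (qsup_ub (fun y => phi x y)).
apply: qsup_le => y; rewrite -rel_extr -(rel_total psi y) tensor_qsupr.
apply: qsup_le => z; apply: le_trans (qsup_ub _ z).
exact: (qsup_ub (fun y => phi x y ⊗ psi y z)).
Qed.

Definition rel_comp : rel_mor X Z :=
  @RelMor d Q X Z (fun x z => \qsup_y (phi x y ⊗ psi y z))
    rel_comp_deltal rel_comp_deltar rel_comp_functional
    rel_comp_extr rel_comp_extl rel_comp_total.

End Comp.

Fact rel_comp_idl (X Y : qset Q) (f : rel_mor X Y) : rel_comp (rel_id Y) f = f.
Proof.
apply: rel_morP => x y /=; apply/le_anti/andP; split.
  by apply: qsup_le => y'; apply: rel_deltar.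
by rewrite -{1}rel_extr; apply: (qsup_ub (fun y' => f x y' ⊗ delta y' y)).
Qed.

Fact rel_comp_idr (X Y : qset Q) (f : rel_mor X Y) : rel_comp f (rel_id X) = f.
Proof.
apply: rel_morP => x y /=; apply/le_anti/andP; split.
  by apply: qsup_le => x'; rewrite delta_sym; apply: rel_deltal.
by rewrite -{1}rel_extl; apply: (qsup_ub (fun x' => delta x x' ⊗ f x' y)).
Qed.

Fact rel_compA (X Y Z T : qset Q)
    (h : rel_mor Z T) (g : rel_mor Y Z) (f : rel_mor X Y) :
  rel_comp h (rel_comp g f) = rel_comp (rel_comp h g) f.
Proof.
apply: rel_morP => x t /=; apply/le_anti/andP; split.
  apply: qsup_le => z; rewrite tensor_qsupl; apply: qsup_le => y.
  apply: (qsup_ub_trans (i := y)); rewrite -tensorA; apply: tensor_ler.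
  exact: (qsup_ub (fun z => g y z ⊗ h z t)).
apply: qsup_le => y; rewrite tensor_qsupr; apply: qsup_le => z.
apply: (qsup_ub_trans (i := z)); rewrite tensorA; apply: tensor_lel.
exact: (qsup_ub (fun y => f x y ⊗ g y z)).
Qed.

Definition QSet_r : category :=
  @Category (qset Q) (@rel_mor d Q) rel_id rel_comp
    rel_comp_idl rel_comp_idr rel_compA.

End QSetCategory.

Arguments QSet_r {d Q} QC QS.

Record is_singleton d (Q : quantaleType d) (X : qset Q) (s : X -> Q) : Prop :=
  IsSingleton {
    singleton_ext : forall x, s x ⊗ extent x = s x;
    singleton_delta : forall x y, s x ⊗ delta x y <= s y;
    singleton_functional : forall x y, s x ⊗ s y <= delta x y;
    singleton_sup : forall x, s x ⊗ \qsup_y s y = s x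
  }.

Definition represents d (Q : quantaleType d) (X : qset Q) (x : X)
    (s : X -> Q) : Prop :=
  forall y, s y = delta y x.

Definition scott_complete d (Q : quantaleType d) (X : qset Q) : Prop :=
  forall s : X -> Q, is_singleton s -> exists! x : X, represents x s.

Definition ScottQSet_r d (Q : quantaleType d)
    (QC : commutative_quantale Q) (QS : semicartesian Q) : category :=
  @full_subcategory (QSet_r QC QS) (@scott_complete d Q).

(* Main.v *)
Require Import Defs.
From mathcomp Require Import all_boot all_order.
From mathcomp Require Import boolp classical_sets.

(** Every Q-set [X] is isomorphic, as an object of the relational category, to
    its completion: the Q-set of all singletons on [X], where the equality of
    [s] and [t] is the supremum of [s x ⊗ t x] over [x].  Completions are
    Scott-complete, so the full subcategory of Scott-complete Q-sets meets every
    isomorphism class, and a full subcategory with that property is equivalent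
    to the whole category ([equivalent_full_subcategory]).

    Strength of the quantale enters only through [singleton_extentE].  The
    supremum [e] of the values of a singleton [s] is idempotent, so strength
    turns [e <= sup s x] into [e <= sup (s x ⊗ s x)]: the extent of [s] in the
    completion is [e].  It therefore acts as a unit on the values of [s], which
    is the extent axiom of the completion.

    The isomorphism between [X] and its completion is evaluation,
    [(x, s) |-> s x], read in both directions.  A singleton [S] on the
    completion is represented by its restriction to the principal singletons
    [delta _ x] ([completion_scott_complete]). *)

Set Implicit Arguments.
Unset Strict Implicit.
Unset Printing Implicit Defensive.

Import Order.TTheory.

Local Open Scope classical_set_scope.
Local Open Scope order_scope.
Local Open Scope cat_scope.
Local Open Scope quantale_scope.

(** * Full subcategories meeting every isomorphism class *)

Section EssentiallyFull.
Variables (C : category) (P : C -> Prop) (r : C -> C).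
Hypothesis Pr : forall x, P (r x).
Variables (i : forall x, hom x (r x)) (j : forall x, hom (r x) x).
Hypothesis jiK : forall x, j x ∘ i x = idm x.
Hypothesis ijK : forall x, i x ∘ j x = idm (r x).

Definition inclusion : functor (full_subcategory P) C :=
  @Functor (full_subcategory P) C (fun x => sval x) (fun _ _ f => f)
    (fun _ => erefl) (fun _ _ _ _ _ => erefl).

Definition retraction_obj (x : C) : full_subcategory P := exist P (r x) (Pr x).

Definition retraction_map (x y : C) (f : hom x y) :
    hom (retraction_obj x) (retraction_obj y) :=
  i y ∘ f ∘ j x.

Fact retraction_id x : retraction_map (idm x) = idm (retraction_obj x).
Proof. by rewrite /retraction_map comp_idr ijK. Qed.

Fact retraction_comp x y z (g : hom y z) (f : hom x y) :
  retraction_map (g ∘ f) = retraction_map g ∘ retraction_map f.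
Proof.
have E : i z ∘ (g ∘ f) ∘ j x = (i z ∘ g ∘ j y) ∘ (i y ∘ f ∘ j x).
  rewrite -!Defs.compA; congr (_ ∘ (_ ∘ _)).
  by rewrite (Defs.compA (j y)) jiK comp_idl.
exact: E.
Qed.

Definition retraction : functor C (full_subcategory P) :=
  @Functor C (full_subcategory P) retraction_obj retraction_map
    retraction_id retraction_comp.

Fact to_retraction_natural (x y : full_subcategory P) (f : hom x y) :
  i (sval y) ∘ (f : @hom C (sval x) (sval y)) =
  i (sval y) ∘ (f : @hom C (sval x) (sval y)) ∘ j (sval x) ∘ i (sval x).
Proof. by rewrite -!Defs.compA jiK comp_idr. Qed.

Definition to_retraction :
    nat_trans (functor_id (full_subcategory P))
      (functor_comp retraction inclusion) :=
  @NatTrans _ _ (functor_id (full_subcategory P))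
    (functor_comp retraction inclusion)
    (fun x => i (sval x)) to_retraction_natural.

Fact of_retraction_natural (x y : C) (f : hom x y) :
  j y ∘ (i y ∘ f ∘ j x) = f ∘ j x.
Proof. by rewrite !Defs.compA jiK comp_idl. Qed.

Definition of_retraction :
    nat_trans (functor_comp inclusion retraction) (functor_id C) :=
  @NatTrans _ _ (functor_comp inclusion retraction) (functor_id C)
    j of_retraction_natural.

(** The retraction acts on morphisms by conjugation with the chosen isomorphisms,
    which makes these isomorphisms natural by construction. *)
Lemma equivalent_full_subcategory :
  equivalent_categories (full_subcategory P) C.
Proof.
exists inclusion, retraction; split.
  exists to_retraction => x; exists (j (sval x)); split; first exact: jiK.
  exact: ijK.
by exists of_retraction => x; exists (i x); split; [exact: ijK|exact: jiK].
Qed.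

End EssentiallyFull.

(** * The completion of a Q-set *)

Section Completion.
Context {d : Order.disp_t} {Q : quantaleType d}.
Hypothesis QC : commutative_quantale Q.
Hypothesis QS : semicartesian Q.

Let tensor_lel1 (a b : Q) : a ⊗ b <= a.
Proof. by apply: le_trans (QS a b) _; apply: leIl. Qed.

Section Singletons.
Variable X : qset Q.
Implicit Types (x y : X) (s t u : X -> Q).

Definition singleton_delta_fun s t : Q := \qsup_x (s x ⊗ t x).

Fact singleton_delta_sym s t : singleton_delta_fun s t = singleton_delta_fun t s.
Proof. by apply: eq_qsup => x; rewrite QC. Qed.

Lemma singleton_eval s t x : is_singleton s -> is_singleton t ->
  s x ⊗ singleton_delta_fun s t <= t x.
Proof.
move=> hs ht; rewrite tensor_qsupr; apply: qsup_le => y; rewrite tensorA.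
apply: (le_trans (tensor_lel _ (singleton_functional hs x y))).
by rewrite QC delta_sym; apply: singleton_delta.
Qed.

Lemma singleton_delta_trans s t u :
  is_singleton s -> is_singleton t -> is_singleton u ->
  singleton_delta_fun s t ⊗ singleton_delta_fun t u <= singleton_delta_fun s u.
Proof.
move=> hs ht hu; rewrite {1}/singleton_delta_fun tensor_qsupl.
apply: qsup_le => x; rewrite -tensorA; apply: (qsup_ub_trans (i := x)).
exact/tensor_ler/singleton_eval.
Qed.

Lemma principal_singleton x : is_singleton (fun y => delta y x).
Proof.
split=> [y|y z|y z|y].
- by rewrite QC delta_ext.
- by rewrite QC (delta_sym y z); apply: delta_trans.
- by rewrite (delta_sym z x); apply: delta_trans.
apply/le_anti/andP; split; first exact: tensor_lel1.
rewrite -[leLHS](rel_id_extr QC); apply: tensor_ler.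
exact: (qsup_ub (fun z => delta z x) x).
Qed.

(** A Yoneda lemma: [s] is monotone along [delta], so the supremum over [y] of
    [delta y x ⊗ s y] is already reached at [y = x]. *)
Lemma singleton_delta_principal x s : is_singleton s ->
  singleton_delta_fun (fun y => delta y x) s = s x.
Proof.
move=> hs; apply/le_anti/andP; split.
  by apply: qsup_le => y; rewrite QC; apply: singleton_delta.
apply: (qsup_ub_trans (i := x)).
by rewrite QC -[leLHS](singleton_ext hs).
Qed.

Hypothesis Qstrong : strong Q.

(** The supremum of the values of a singleton is idempotent, so strength bounds
    it by the supremum of the squares of these values. *)
Lemma singleton_extentE s : is_singleton s ->
  singleton_delta_fun s s = \qsup_x s x.
Proof.
move=> hs; apply/le_anti/andP; split.
  by apply: qsup_le => x; apply: (qsup_ub_trans (i := x)).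
have idem : \qsup_x s x = (\qsup_x s x) ⊗ (\qsup_x s x).
  by rewrite tensor_qsupl; apply: eq_qsup => x; rewrite singleton_sup.
by have := Qstrong idem (lexx _); rewrite image_comp.
Qed.

Lemma singleton_delta_ext s t : is_singleton s ->
  singleton_delta_fun s s ⊗ singleton_delta_fun s t = singleton_delta_fun s t.
Proof.
move=> hs; rewrite singleton_extentE // [in LHS]/singleton_delta_fun tensor_qsupr.
by apply: eq_qsup => x; rewrite tensorA (QC _ (s x)) singleton_sup.
Qed.

Definition completion : qset Q :=
  @QSet d Q {s : X -> Q | is_singleton s}
    (fun f g => singleton_delta_fun (sval f) (sval g))
    (fun f g => singleton_delta_sym (sval f) (sval g))
    (fun f g h => singleton_delta_trans (svalP f) (svalP g) (svalP h))
    (fun f g => singleton_delta_ext (sval g) (svalP f)).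

Implicit Types f g : completion.

Definition principal x : completion :=
  exist _ (fun y => delta y x) (principal_singleton x).

Lemma delta_principal x f : delta (principal x) f = sval f x.
Proof. exact: singleton_delta_principal (svalP f). Qed.

Lemma completion_extent f : extent f = \qsup_x sval f x.
Proof. exact: singleton_extentE (svalP f). Qed.

Lemma eval_extent x f : sval f x ⊗ extent f = sval f x.
Proof. by rewrite completion_extent singleton_sup //; apply: svalP. Qed.

(** * Evaluation as an isomorphism *)

Fact eval_deltal x x' f : delta x x' ⊗ sval f x <= sval f x'.
Proof. by rewrite QC; apply: singleton_delta (svalP f) _ _. Qed.

Fact eval_deltar x f g : sval f x ⊗ delta f g <= sval g x.
Proof. exact: singleton_eval (svalP f) (svalP g). Qed.

Fact eval_functional x f g : sval f x ⊗ sval g x <= delta f g.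
Proof. exact: (qsup_ub (fun x => sval f x ⊗ sval g x)). Qed.

Fact eval_extl x f : extent x ⊗ sval f x = sval f x.
Proof. by rewrite QC; apply: singleton_ext (svalP f) _. Qed.

Fact eval_total x : \qsup_f (sval (f : completion) x) = extent x.
Proof.
apply/le_anti/andP; split.
  by apply: qsup_le => f; rewrite -eval_extl; apply: tensor_lel1.
exact: (qsup_ub (fun f : completion => sval f x) (principal x)).
Qed.

Definition to_completion : rel_mor X completion :=
  @RelMor d Q X completion (fun x f => sval f x)
    eval_deltal eval_deltar eval_functional eval_extent eval_extl eval_total.

Fact coeval_deltal f g x : delta f g ⊗ sval f x <= sval g x.
Proof. by rewrite QC; apply: eval_deltar. Qed.

Fact coeval_deltar f x x' : sval f x ⊗ delta x x' <= sval f x'.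
Proof. by rewrite QC; apply: eval_deltal. Qed.

Fact coeval_functional f x y : sval f x ⊗ sval f y <= delta x y.
Proof. exact: singleton_functional (svalP f) _ _. Qed.

Fact coeval_extr f x : sval f x ⊗ extent x = sval f x.
Proof. by rewrite QC; apply: eval_extl. Qed.

Fact coeval_extl f x : extent f ⊗ sval f x = sval f x.
Proof. by rewrite QC; apply: eval_extent. Qed.

Definition of_completion : rel_mor completion X :=
  @RelMor d Q completion X (fun f x => sval f x)
    coeval_deltal coeval_deltar coeval_functional coeval_extr coeval_extl
    (fun f => esym (completion_extent f)).

(** The supremum over all singletons [f] of [f x ⊗ f y] is attained at the
    principal singleton of [x]. *)
Lemma of_completionK :
  rel_comp QC QS of_completion to_completion = rel_id QC QS X.
Proof.
apply: rel_morP => x y /=; apply/le_anti/andP; split.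
  by apply: qsup_le => f; apply: coeval_functional.
apply: (qsup_ub_trans (i := principal x)) => /=.
by rewrite (delta_sym y x) delta_ext.
Qed.

Lemma to_completionK :
  rel_comp QC QS to_completion of_completion = rel_id QC QS completion.
Proof. exact: rel_morP. Qed.

(** * Scott-completeness of the completion *)

(** Only the last axiom needs an argument: restricting [S] must not decrease the
    supremum of its values.  The extent of [f] is the supremum of the values
    [f x = delta f (principal x)], so [S f] is the supremum of the products
    [S f ⊗ delta f (principal x)], each at most [S (principal x)]. *)
Lemma restriction_singleton (S : completion -> Q) : is_singleton S ->
  is_singleton (fun x => S (principal x)).
Proof.
move=> hS; split=> [x|x y|x y|x].
- have -> : extent x = extent (principal x).
    by rewrite /extent delta_principal.
  exact: singleton_ext hS _.
- have -> : delta x y = delta (principal x) (principal y).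
    by rewrite delta_principal.
  exact: singleton_delta hS _ _.
- have -> : delta x y = delta (principal x) (principal y).
    by rewrite delta_principal.
  exact: singleton_functional hS _ _.
apply/le_anti/andP; split; first exact: tensor_lel1.
rewrite -[leLHS](singleton_sup hS); apply: tensor_ler; apply: qsup_le => f.
rewrite -(singleton_ext hS) completion_extent tensor_qsupr.
apply: qsup_le => x'; apply: (qsup_ub_trans (i := x')).
by rewrite -delta_principal delta_sym; apply: singleton_delta hS _ _.
Qed.

(** Uniqueness holds because pairing with principal singletons recovers the
    values of an element of the completion. *)
Lemma completion_scott_complete : scott_complete completion.
Proof.
move=> S hS; exists (exist _ _ (restriction_singleton hS)); split.
  move=> f; apply/le_anti/andP; split.
    (* The extent of [f] is a supremum of squares: one factor [f x] moves [S]
       from [f] to [principal x], the other one remains. *)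
    rewrite -(singleton_ext hS) {1}/extent /= /singleton_delta_fun tensor_qsupr.
    apply: qsup_le => x; apply: (qsup_ub_trans (i := x)) => /=.
    rewrite tensorA (QC (sval f x)); apply: tensor_lel.
    by rewrite -delta_principal delta_sym; apply: singleton_delta hS _ _.
  apply: qsup_le => x /=; rewrite QC -delta_principal.
  exact: singleton_delta hS _ _.
move=> [g hg] Sg; apply: eq_exist; apply/funext => x.
by rewrite Sg delta_principal.
Qed.

End Singletons.
End Completion.

Theorem mainTheorem6 (d : Order.disp_t) (Q : quantaleType d)
    (Qcomm : commutative_quantale Q) (Qsemi : semicartesian Q)
    (Qstrong : strong Q) :
  equivalent_categories (ScottQSet_r Qcomm Qsemi) (QSet_r Qcomm Qsemi).
Proof.
pose r (X : qset Q) : qset Q := completion Qcomm Qsemi X Qstrong.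
pose Pr (X : qset Q) : scott_complete (r X) :=
  @completion_scott_complete d Q Qcomm Qsemi X Qstrong.
pose i (X : qset Q) : rel_mor X (r X) := to_completion Qcomm Qsemi X Qstrong.
pose j (X : qset Q) : rel_mor (r X) X := of_completion Qcomm Qsemi X Qstrong.
apply: (@equivalent_full_subcategory (QSet_r Qcomm Qsemi)
  (@scott_complete d Q) r Pr i j) => X.
- exact: of_completionK.
- exact: to_completionK.
Qed.
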